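(* Let $\hat\rho_\theta$, $\theta\in\mathbb{R}^{N_\theta}$, be a parameterized (full-rank) density operator, let $f,\tilde f:\mathbb{R}_{\ge 0}\to\mathbb{R}_{\ge 0}$ be Petz functions, and let $\bar g_{\hat\rho_\theta,f}(\cdot,\cdot)$ and $\bar g_{\hat\rho_\theta,\tilde f}(\cdot,\cdot)$ be the diagonal approximations of the quantum Fisher metrics at $\hat\rho_\theta$ associated with $f$ and $\tilde f$, respectively. Then $$f\preceq\tilde f\quad\Longleftrightarrow\quad \bar g_{\hat\rho_\theta,f}(\cdot,\cdot)\succeq \bar g_{\hat\rho_\theta,\tilde f}(\cdot,\cdot),$$ where $f\preceq\tilde f$ means $f(t)\le\tilde f(t)$ for all $t\in\mathbb{R}_{\ge 0}$, and, for metrics $g,\tilde g$, $g\succeq\tilde g$ means $g(X,X)\ge\tilde g(X,X)$ for all tangent vectors $X$.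
   Context: The density operator is written as $\hat\rho_\theta=\sum_{i=1}^N p_i|\psi_i\rangle\langle\psi_i|$ with $\langle\psi_i|\psi_j\rangle=\delta_{i,j}$, $\mathrm{Tr}[\hat\rho_\theta]=1$ and $p_i>0$ (full rank); both the $p_i$ and the $|\psi_i\rangle$ may depend on the parameter $\theta\in\mathbb{R}^{N_\theta}$. A Petz function is a function $f:\mathbb{R}_{\ge 0}\to\mathbb{R}_{\ge 0}$ satisfying $f(1)=1$ and $f(t)=t\,f(t^{-1})$. A tangent vector is $X=\sum_{i=1}^{N_\theta}X^i\partial_i$ with $\partial_i=\partial/\partial\theta^i$. Write $\hat X^{\mathrm m}_{\hat\rho_\theta}:=X\hat\rho_\theta$ (the derivative of $\hat\rho_\theta$ along $X$). The quantum Fisher metric associated with $f$ is $$g_{\hat\rho_\theta,f}(X,Y)=\sum_{i,j=1}^N\frac{1}{p_j f(p_i/p_j)}\langle\psi_j|\hat X^{\mathrm m}_{\hat\rho_\theta}|\psi_i\rangle\langle\psi_i|\hat Y^{\mathrm m}_{\hat\rho_\theta}|\psi_j\rangle .$$ Its diagonal approximation $\bar g_{\hat\rho_\theta,f}$ is the metric (bilinear form) with $\bar g_{\hat\rho_\theta,f}(\partial_i,\partial_j)=g_{\hat\rho_\theta,f}(\partial_i,\partial_j)$ if $i=j$ and $\bar g_{\hat\rho_\theta,f}(\partial_i,\partial_j)=0$ if $i\ne j$.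
   Formalization: The metric inequality is required for all density operator families and all θ (for one fixed, e.g. constant, family the converse fails); N≥2, N_θ≥1; f, f̃ are positive for t>0; at t=0 the equation f(t)=t f(1/t) is read as a limit t→0+. *)

(* Defs.v *)
From mathcomp Require Import all_boot all_order all_algebra.
From mathcomp Require Import all_classical all_reals all_analysis.
From mathcomp Require Import complex.
Set Implicit Arguments.
Unset Strict Implicit.
Unset Printing Implicit Defensive.
Import Order.TTheory GRing.Theory Num.Theory.
Import numFieldNormedType.Exports.
Local Open Scope classical_set_scope.
Local Open Scope sesquilinear_scope.
Local Open Scope complex_scope.
Local Open Scope ring_scope.

(* A function on the nonnegative reals is represented by f : R -> R, whose
   values at negative arguments are never used.  The functional equation
   f(t) = t f(1/t) is required literally for t > 0; at t = 0, where 1/t is not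
   a real number, it is read as f(0) = lim_(t -> 0+) t f(1/t).  (The library
   convention 0^-1 = 0 would instead force f 0 = 0 and exclude, for example,
   f(t) = (1 + t)/2.) *)
Record petz_function (R : realType) (f : R -> R) : Prop := PetzFunction {
  petz_ge0 : forall t, 0 <= t -> 0 <= f t ;
  petz1 : f 1 = 1 ;
  petz_sym : forall t, 0 < t -> f t = t * f t^-1 ;
  petz_sym0 : t * f t^-1 @[t --> 0^'+] --> f 0 }.

Definition petz_le (R : realType) (f g : R -> R) : Prop :=
  forall t, 0 <= t -> f t <= g t.

Section DensityOperators.
Context {R : realType} {N n : nat}.
Local Notation C := R[i].

(* <phi|A|psi> *)
Definition sandwich (phi : 'cV[C]_N) (A : 'M[C]_N) (psi : 'cV[C]_N) : C :=
  (phi ^t* *m A *m psi) 0 0.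

(* N orthonormal kets in C^N with positive weights: full rank. *)
Definition spectral_sum (p : 'I_N -> R) (psi : 'I_N -> 'cV[C]_N) : 'M[C]_N :=
  \sum_(i < N) (p i)%:C *: (psi i *m (psi i) ^t*).

(* Only the density operator itself has to be differentiable; the spectral
   decomposition may depend on the parameter in an arbitrary way. *)
Record density_family := DensityFamily {
  prob : 'rV[R]_n -> 'I_N -> R ;
  ket : 'rV[R]_n -> 'I_N -> 'cV[C]_N ;
  rho := fun theta => spectral_sum (prob theta) (ket theta) ;
  prob_gt0 : forall theta i, 0 < prob theta i ;
  ket_orthonormal : forall theta i j,
    sandwich (ket theta i) 1%:M (ket theta j) = (i == j)%:R ;
  rho_trace : forall theta, \tr (rho theta) = 1 ;
  rho_diff : forall theta a b,
    differentiable (fun u => complex.Re (rho u a b)) theta /\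
    differentiable (fun u => complex.Im (rho u a b)) theta }.

(* The tangent vector X = \sum_i X^i d/dtheta^i is the row (X^i)_i; X rho is
   the entrywise directional derivative. *)
Definition mrep (S : density_family) (theta X : 'rV[R]_n) : 'M[C]_N :=
  \matrix_(a, b)
    ('D_X (fun u => complex.Re (rho S u a b)) theta +i*
     'D_X (fun u => complex.Im (rho S u a b)) theta).

Definition fisher (f : R -> R) (S : density_family) (theta : 'rV[R]_n)
    (X Y : 'rV[R]_n) : C :=
  let p := prob S theta in
  let psi := ket S theta in
  \sum_(i < N) \sum_(j < N)
    (1 / (p j * f (p i / p j)))%:C *
    sandwich (psi j) (mrep S theta X) (psi i) *
    sandwich (psi i) (mrep S theta Y) (psi j).

Definition coord_vec (k : 'I_n) : 'rV[R]_n := delta_mx 0 k.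

(* The bilinear form whose matrix in the basis d/dtheta^k is the diagonal part
   of that of g. *)
Definition diag_approx (g : 'rV[R]_n -> 'rV[R]_n -> C) (X Y : 'rV[R]_n) : C :=
  \sum_(k < n) \sum_(l < n)
    (X 0 k)%:C * (Y 0 l)%:C *
    (if k == l then g (coord_vec k) (coord_vec l) else 0).

Definition diag_fisher (f : R -> R) (S : density_family) (theta : 'rV[R]_n) :=
  diag_approx (fisher f S theta).

(* The order of R[i] makes x <= y mean that y - x is a nonnegative real. *)
Definition metric_ge (g h : 'rV[R]_n -> 'rV[R]_n -> C) : Prop :=
  forall X, h X X <= g X X.

End DensityOperators.
Arguments density_family : clear implicits.

(* Main.v *)
(** In the diagonal approximation, g(X,X) = sum_k (X^k)^2 g(e_k,e_k), and since
    the derivative of rho is Hermitian, g(e_k,e_k) is a sum of squared moduli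
    with weights 1 / (p_j f(p_i/p_j)); these weights decrease when f increases.
    Conversely, for t > 0, take weights proportional to (t, 1, 1, ..., 1) and a
    basis that rotates in the plane of the first two vectors: the diagonal
    entry of the metric is then K (t-1)^2 / f(t), with K > 0 independent of f,
    so comparing the metrics compares f(t) with ft(t) when t <> 1.  At t = 1
    both functions equal 1, and at t = 0 the inequality passes to the limit. *)

Require Import Defs.
From HB Require Import structures.
From mathcomp Require Import all_boot all_order all_algebra.
From mathcomp Require Import all_classical all_reals all_analysis.
From mathcomp Require Import complex ring.
Import Order.TTheory GRing.Theory Num.Theory.
Import numFieldNormedType.Exports.
Local Open Scope ring_scope.

(** * Hermitian symmetry and monotonicity of the Fisher metric *)

Lemma sandwichE (R : realType) (N : nat) (phi psi : 'cV[R[i]]_N)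
    (A : 'M[R[i]]_N) :
  sandwich phi A psi =
  \sum_(a < N) \sum_(b < N) conjc (phi a 0) * A a b * psi b 0.
Proof.
rewrite /sandwich -mulmxA mxE; apply: eq_bigr => a _.
rewrite !mxE big_distrr /=; apply: eq_bigr => b _.
by rewrite mulrA.
Qed.

Lemma sandwich_conj (R : realType) (N : nat) (phi psi : 'cV[R[i]]_N)
    (A : 'M[R[i]]_N) :
  (forall a b, A b a = conjc (A a b)) ->
  sandwich psi A phi = conjc (sandwich phi A psi).
Proof.
move=> Aherm; rewrite !sandwichE exchange_big rmorph_sum; apply: eq_bigr => a _.
rewrite rmorph_sum /=; apply: eq_bigr => b _.
rewrite !rmorphM /= Aherm conjcK; ring.
Qed.

Lemma spectral_sumE (R : realType) (N : nat) (p : 'I_N -> R)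
    (psi : 'I_N -> 'cV[R[i]]_N) a b :
  spectral_sum p psi a b =
  \sum_(i < N) (real_complex R (p i)) * (psi i a 0 * conjc (psi i b 0)).
Proof.
rewrite /spectral_sum summxE; apply: eq_bigr => i _.
by rewrite !mxE big_ord1 !mxE.
Qed.

Lemma rho_herm (R : realType) (N n : nat) (S : density_family R N n) u a b :
  rho S u b a = conjc (rho S u a b).
Proof.
rewrite /rho !spectral_sumE rmorph_sum; apply: eq_bigr => i _.
by rewrite !rmorphM /= oppr0 conjcK [conjc _ * _]mulrC.
Qed.

Lemma mrep_herm (R : realType) (N n : nat) (S : density_family R N n)
    (theta X : 'rV[R]_n) a b :
  mrep S theta X b a = conjc (mrep S theta X a b).
Proof.
have [_ dIm] := rho_diff S theta a b.
rewrite !mxE /=.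
have -> : (fun u => complex.Re (rho S u b a)) = (fun u => complex.Re (rho S u a b)).
  by apply/funext => u; rewrite rho_herm; case: (rho S u a b).
have -> : (fun u => complex.Im (rho S u b a)) = - (fun u => complex.Im (rho S u a b)).
  by apply/funext => u; rewrite rho_herm fctE; case: (rho S u a b).
by rewrite deriveN //; apply: diff_derivable.
Qed.

Lemma le_fisher (R : realType) (N n : nat) (S : density_family R N n)
    (f ft : R -> R) (theta X : 'rV[R]_n) :
  (forall t, 0 < t -> 0 < f t) -> (forall t, 0 < t -> f t <= ft t) ->
  fisher ft S theta X X <= fisher f S theta X X.
Proof.
move=> f_gt0 le_f; apply: ler_sum => i _; apply: ler_sum => j _.
rewrite -!mulrA ler_wpM2r //.
  (* The two sandwiches are conjugate to each other, so their product is a squared modulus. *)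
  rewrite (sandwich_conj _ _ (ket S theta j)); first exact: mulcJ_ge0.
  by move=> a b; apply: mrep_herm.
have pi_gt0 := prob_gt0 S theta i; have pj_gt0 := prob_gt0 S theta j.
have pij_gt0 := divr_gt0 pi_gt0 pj_gt0.
rewrite lecR !div1r lef_pV2 ?posrE ?mulr_gt0 ?f_gt0
  ?(lt_le_trans (f_gt0 _ _) (le_f _ _)) //.
by rewrite ler_pM2l// le_f.
Qed.

(** * Reduction to coordinate directions and to positive arguments *)

Lemma diag_approxE (R : realType) (n : nat) (g : 'rV[R]_n -> 'rV[R]_n -> R[i]) X :
  diag_approx g X X =
  \sum_(k < n) real_complex R (X 0 k ^+ 2) * g (coord_vec k) (coord_vec k).
Proof.
apply: eq_bigr => k _; rewrite (bigD1 k) //= eqxx big1 ?addr0.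
  by rewrite -rmorphM expr2.
by move=> l /negPf lk; rewrite eq_sym lk mulr0.
Qed.

Lemma diag_approx_coord (R : realType) (n : nat) (g : 'rV[R]_n -> 'rV[R]_n -> R[i]) k :
  diag_approx g (coord_vec k) (coord_vec k) = g (coord_vec k) (coord_vec k).
Proof.
rewrite diag_approxE (bigD1 k) //= mxE !eqxx expr1n mul1r big1 ?addr0 //.
by move=> l /negPf lk; rewrite mxE lk expr0n mul0r.
Qed.

Lemma petz_le_of_gt0 (R : realType) (f ft : R -> R) :
  petz_function f -> petz_function ft ->
  (forall t, 0 < t -> f t <= ft t) -> petz_le f ft.
Proof.
move=> hf hft le_f t; rewrite le_eqVlt => /predU1P[<-|]; last exact: le_f.
(* Both values at 0 are limits of [s * f s^-1] as [s] tends to 0 from the right, so only positive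
   arguments get compared. *)
apply: (ler_cvg_to (petz_sym0 hf) (petz_sym0 hft)).
near=> s.
by rewrite ler_pM2l ?le_f ?invr_gt0.
Unshelve. all: by end_near. Qed.

(** Both sides are limits of the same difference quotient, so no differentiability is required. *)
Lemma derive_coord (R : realType) (n : nat) (F : R -> R) k (x : 'rV[R]_n) :
  'D_(coord_vec k) (fun u : 'rV[R]_n => F (u 0 k) : R) x = 'D_1 F (x 0 k).
Proof.
by rewrite /derive; under eq_fun do rewrite /= !mxE !eqxx.
Qed.

(** * Orthonormal bases obtained from a turning Householder reflection *)

Section Mirror.
Variables (R : realType) (N n : nat).

Definition reflection (v : 'cV[R]_N) : 'M[R]_N := 1%:M - 2 *: (v *m v^T).

Lemma reflection_tr v : (reflection v)^T = reflection v.
Proof. by rewrite /reflection linearB linearZ /= trmx1 trmx_mul trmxK. Qed.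

Lemma reflectionK v : v^T *m v = 1%:M -> reflection v *m reflection v = 1%:M.
Proof.
move=> v1; have PP : v *m v^T *m (v *m v^T) = v *m v^T.
  by rewrite mulmxA -[v *m v^T *m v]mulmxA v1 mulmx1.
rewrite /reflection mulmxBl mul1mx mulmxBr mulmx1 -scalemxAr -scalemxAl PP.
by apply/matrixP => a b; rewrite !mxE; ring.
Qed.

Variables (i0 i1 : 'I_N) (i01 : i0 != i1).

(* The mirror's normal turns with the parameter; at s = 0 the reflection is
   diagonal, so the basis there is the standard one up to signs. *)
Definition normal_vec (s : R) : 'cV[R]_N :=
  sin s *: delta_mx i0 0 - cos s *: delta_mx i1 0.

Lemma normal_vecE s a :
  normal_vec s a 0 = sin s * (a == i0)%:R - cos s * (a == i1)%:R.
Proof. by rewrite !mxE eqxx !andbT. Qed.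

Lemma normal_vec_unit s : (normal_vec s)^T *m normal_vec s = 1%:M.
Proof.
apply/matrixP => a b; rewrite !ord1 !mxE eqxx.
under eq_bigr do rewrite [X in X * _]mxE normal_vecE.
have i10 : (i1 == i0) = false by rewrite eq_sym (negPf i01).
rewrite (bigD1 i0) //= (bigD1 i1) /=; last by rewrite i10.
rewrite big1 ?addr0 => [|a' /andP[/negPf-> /negPf->]].
  rewrite !eqxx (negPf i01) i10.
  by rewrite !mulr1 !mulr0 subr0 sub0r -!expr2 sqrrN addrC cos2Dsin2.
by rewrite !mulr0 subr0 mul0r.
Qed.

Definition mirror (s : R) : 'M[R]_N := reflection (normal_vec s).

Lemma mirrorC s a b : mirror s a b = mirror s b a.
Proof. by rewrite /mirror -[in LHS]reflection_tr mxE. Qed.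

(** A symmetric involution is orthogonal. *)
Lemma mirror_orthonormal s i j :
  \sum_(a < N) mirror s i a * mirror s j a = (i == j)%:R.
Proof.
have /matrixP/(_ i j) := reflectionK _ (normal_vec_unit s).
rewrite !mxE => <-; apply: eq_bigr => a _.
by rewrite (mirrorC s j).
Qed.

Lemma mirrorE s a b : mirror s a b =
  (a == b)%:R - 2 * ((sin s * (a == i0)%:R - cos s * (a == i1)%:R) *
                     (sin s * (b == i0)%:R - cos s * (b == i1)%:R)).
Proof.
by rewrite /mirror /reflection !mxE big_ord1 [_^T 0 b]mxE !normal_vecE.
Qed.

Lemma mirror0E a b : mirror 0 a b = (a == b)%:R * (if a == i1 then -1 else 1).
Proof.
rewrite mirrorE sin0 cos0 !mul0r !sub0r !mul1r.
case: (eqVneq a i1) => [->|_]; case: (eqVneq b i1) => _ /=; ring.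
Qed.

(** * The test family of density operators *)

Variables (t : R) (t_gt0 : 0 < t) (k0 : 'I_n).

(** Normalizes one weight [t] and [N - 1] weights 1 to total 1. *)
Let c := (t + N%:R - 1)^-1.

Lemma mirror_weight_gt0 : 0 < c.
Proof.
rewrite invr_gt0 -addrA ltr_wpDr// subr_ge0 ler1n.
(* The index [i0] rules out [N = 0], hence [t + N - 1] is at least [t]. *)
by case: {+}N i0 => // -[].
Qed.

Definition mirror_prob (i : 'I_N) : R := if i == i0 then t * c else c.

Lemma mirror_prob_gt0 i : 0 < mirror_prob i.
Proof.
have := mirror_weight_gt0.
by rewrite /mirror_prob; case: ifP => // _ c_gt0; rewrite mulr_gt0.
Qed.

Lemma sum_mirror_prob : \sum_i mirror_prob i = 1.
Proof.
transitivity (\sum_(i < N) (c + (if i == i0 then (t - 1) * c else 0))).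
  by apply: eq_bigr => i _; rewrite /mirror_prob; case: ifP => _; ring.
rewrite big_split /= sumr_const card_ord -big_mkcond big_pred1_eq.
have := mirror_weight_gt0; rewrite invr_gt0 => /lt0r_neq0 c0.
rewrite -mulr_natl -mulrDl -[RHS](mulfV c0); congr (_ * _); ring.
Qed.

Definition mirror_ket (s : R) (i : 'I_N) : 'cV[R[i]]_N :=
  map_mx (real_complex R) (col i (mirror s)).

Lemma mirror_ketE s i a : mirror_ket s i a 0 = real_complex R (mirror s a i).
Proof. by rewrite !mxE. Qed.

(* Only ket i0 has an exceptional weight, so completeness of the basis leaves a
   rank-one perturbation of the scalar matrix c. *)
Definition mirror_rho (s : R) a b : R :=
  c * ((a == b)%:R + (t - 1) * (mirror s a i0 * mirror s b i0)).

Lemma mirror_spectral s a b :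
  spectral_sum mirror_prob (mirror_ket s) a b = real_complex R (mirror_rho s a b).
Proof.
rewrite spectral_sumE.
under eq_bigr do rewrite !mirror_ketE conjc_real -!rmorphM.
rewrite -rmorph_sum; congr (real_complex R _).
transitivity (\sum_(i < N) (c * (mirror s a i * mirror s b i) +
  (if i == i0 then c * ((t - 1) * (mirror s a i * mirror s b i)) else 0))).
  by apply: eq_bigr => i _; rewrite /mirror_prob; case: ifP => _; ring.
rewrite big_split /= -big_distrr /= mirror_orthonormal -big_mkcond big_pred1_eq.
by rewrite /mirror_rho mulrDr.
Qed.

Lemma mirror_ket_orthonormal s i j :
  sandwich (mirror_ket s i) 1%:M (mirror_ket s j) = (i == j)%:R.
Proof.
rewrite sandwichE.
transitivity (real_complex R (\sum_(a < N) mirror s i a * mirror s j a)); last first.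
  by rewrite mirror_orthonormal rmorph_nat.
rewrite rmorph_sum; apply: eq_bigr => a _.
rewrite (bigD1 a)//= big1 ?addr0 => [|b /negPf ba].
  by rewrite !mirror_ketE conjc_real [1%:M a a]mxE eqxx mulr1 -rmorphM !(mirrorC _ a).
by rewrite [1%:M a b]mxE eq_sym ba mulr0 mul0r.
Qed.

Lemma mirror_trace s : \tr (spectral_sum mirror_prob (mirror_ket s)) = 1.
Proof.
rewrite /mxtrace; under eq_bigr do rewrite spectral_sumE.
rewrite exchange_big /= -[RHS](rmorph1 (real_complex R)) -sum_mirror_prob rmorph_sum.
apply: eq_bigr => i _; rewrite -big_distrr /= -[RHS]mulr1; congr (_ * _).
transitivity (real_complex R (\sum_(a < N) mirror s i a * mirror s i a)); last first.
  by rewrite mirror_orthonormal eqxx.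
rewrite rmorph_sum; apply: eq_bigr => a _.
by rewrite mirror_ketE conjc_real -rmorphM mirrorC.
Qed.

Lemma mirror_is_derive (s : R) a b : is_derive s 1 (fun s => mirror s a b : R)
  (- 2 * ((cos s * (a == i0)%:R + sin s * (a == i1)%:R) *
          (sin s * (b == i0)%:R - cos s * (b == i1)%:R) +
          (sin s * (a == i0)%:R - cos s * (a == i1)%:R) *
          (cos s * (b == i0)%:R + sin s * (b == i1)%:R))).
Proof.
under eq_fun do rewrite mirrorE.
apply: is_derive_eq.
rewrite /GRing.scale /=; ring.
Qed.

(** Away from 0 only the existence of the derivative matters, for differentiability of the
    family. *)
Lemma mirror_rho_is_derive (s : R) a b :
  exists d, is_derive s 1 (fun s => mirror_rho s a b : R) d.
Proof.
have da := mirror_is_derive s a i0; have db := mirror_is_derive s b i0.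
by eexists.
Qed.

(** At 0, column [i0] of the mirror is the standard vector [i0], moving with velocity twice the
    standard vector [i1]: a reflection turns twice as fast as its normal. The product rule then
    gives a symmetric off-diagonal matrix. *)
Lemma mirror_rho_derive0 a b :
  is_derive (0 : R) 1 (fun s => mirror_rho s a b : R)
    (2 * c * (t - 1) *
      ((a == i0)%:R * (b == i1)%:R + (a == i1)%:R * (b == i0)%:R)).
Proof.
have da := mirror_is_derive 0 a i0; have db := mirror_is_derive 0 b i0.
apply: is_derive_eq.
rewrite /GRing.scale /= !mirror0E sin0 cos0 eqxx (negPf i01).
case: (eqVneq a i1) => [->|_]; case: (eqVneq b i1) => [->|_];
  rewrite ?eqxx ?[i1 == i0]eq_sym ?(negPf i01) /=; ring.
Qed.

Lemma mirror_rho_differentiable a b (theta : 'rV[R]_n) :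
  differentiable (fun u : 'rV[R]_n => mirror_rho (u 0 k0) a b) theta.
Proof.
have [d dd] := mirror_rho_is_derive (theta 0 k0) a b.
apply: (@differentiable_comp _ _ _ _ (fun u : 'rV[R]_n => u 0 k0)
  (fun s => mirror_rho s a b : R)).
  exact: differentiable_coord.
by apply/derivable1_diffP.
Qed.

Lemma mirror_rho_diff a b (theta : 'rV[R]_n) :
  differentiable (fun u : 'rV[R]_n =>
    complex.Re (spectral_sum mirror_prob (mirror_ket (u 0 k0)) a b)) theta /\
  differentiable (fun u : 'rV[R]_n =>
    complex.Im (spectral_sum mirror_prob (mirror_ket (u 0 k0)) a b)) theta.
Proof.
split; under eq_fun do rewrite mirror_spectral /=.
  exact: mirror_rho_differentiable.
exact: differentiable_cst.
Qed.

Definition mirror_family : density_family R N n :=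
  @DensityFamily R N n (fun=> mirror_prob) (fun u => mirror_ket (u 0 k0))
    (fun=> mirror_prob_gt0) (fun u => mirror_ket_orthonormal (u 0 k0))
    (fun u => mirror_trace (u 0 k0)) (fun u a b => mirror_rho_diff a b u).

(** * The Fisher metric of the test family at parameter 0 *)

Lemma mirror_mrep a b :
  mrep mirror_family 0 (coord_vec k0) a b = real_complex R
    (2 * c * (t - 1) *
      ((a == i0)%:R * (b == i1)%:R + (a == i1)%:R * (b == i0)%:R)).
Proof.
have rhoE u : rho mirror_family u a b = real_complex R (mirror_rho (u 0 k0) a b).
  exact: mirror_spectral.
rewrite mxE; under eq_fun do rewrite rhoE /=.
rewrite (_ : (fun u => complex.Im _) = cst 0); last first.
  by apply/funext => u; rewrite rhoE.
rewrite derive_cst (derive_coord _ _ (fun s => mirror_rho s a b)) mxE.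
by have [_ ->] := mirror_rho_derive0 a b.
Qed.

(** The kets are standard vectors except for a sign on ket [i1]. Each nonzero entry involves [i1]
    exactly once, whence the global minus. *)
Lemma mirror_sandwich i j :
  sandwich (ket mirror_family 0 j) (mrep mirror_family 0 (coord_vec k0))
    (ket mirror_family 0 i) =
  - real_complex R
    (2 * c * (t - 1) *
      ((j == i0)%:R * (i == i1)%:R + (j == i1)%:R * (i == i0)%:R)).
Proof.
have ketE l a : ket mirror_family 0 l a 0 =
    real_complex R ((a == l)%:R * (if a == i1 then -1 else 1)).
  by rewrite /= [(0 : 'rV[R]_n) 0 k0]mxE mirror_ketE mirror0E.
rewrite sandwichE; under eq_bigr do under eq_bigr do
  rewrite !ketE conjc_real mirror_mrep -!rmorphM.
rewrite (bigD1 j) //= [X in _ + X]big1 ?addr0; last first.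
  by move=> a /negPf aj; rewrite big1 // => b _; rewrite aj !mul0r.
rewrite (bigD1 i) //= big1 ?addr0; last first.
  by move=> b /negPf bi; rewrite bi mul0r mulr0.
rewrite -rmorphN; congr (real_complex R _); rewrite !eqxx.
have i10 : (i1 == i0) = false by rewrite eq_sym (negPf i01).
by case: (eqVneq j i1) => [->|_]; case: (eqVneq i i1) => [->|_] /=; rewrite ?i10 /=; ring.
Qed.

(** Only the pairs [(i0, i1)] and [(i1, i0)] contribute, each with weight [1 / (c * g t)]; the
    constant is twice [(2 * c * (t - 1)) ^+ 2 / c]. *)
Lemma mirror_fisher (g : R -> R) : petz_function g ->
  fisher g mirror_family 0 (coord_vec k0) (coord_vec k0) =
  real_complex R (8 * c * (t - 1) ^+ 2 * (g t)^-1).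
Proof.
move=> hg; rewrite /fisher.
have i10 : (i1 == i0) = false by rewrite eq_sym (negPf i01).
have c0 := lt0r_neq0 mirror_weight_gt0; have t0 := lt0r_neq0 t_gt0.
have pick_pair (F : 'I_N -> 'I_N -> R) k l :
    \sum_(i < N) \sum_(j < N) F i j * ((i == k) && (j == l))%:R = F k l.
  rewrite (bigD1 k) //= (bigD1 l) //= !eqxx mulr1 big1 ?addr0 => [|j /negPf->].
    by rewrite big1 ?addr0 // => i /negPf->; rewrite big1 // => j _; rewrite mulr0.
  by rewrite mulr0.
pose w i j := 1 / (mirror_prob j * g (mirror_prob i / mirror_prob j)).
transitivity (real_complex R (\sum_(i < N) \sum_(j < N)
    ((2 * c * (t - 1)) ^+ 2 * w i j * ((i == i0) && (j == i1))%:R +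
     (2 * c * (t - 1)) ^+ 2 * w i j * ((i == i1) && (j == i0))%:R))).
  rewrite rmorph_sum; apply: eq_bigr => i _; rewrite rmorph_sum; apply: eq_bigr => j _.
  rewrite !mirror_sandwich -mulrA mulrNN -!(rmorphM (real_complex R)) /w.
  congr (real_complex R _).
  (* The two indicators exclude each other, so the square of their sum has no cross term. *)
  case: (eqVneq i i0) => [->|_]; case: (eqVneq j i0) => [->|_];
    rewrite ?(negPf i01) /=; case: (i == i1); case: (j == i1) => /=; ring.
congr (real_complex R _); under eq_bigr do rewrite big_split.
rewrite big_split /= !pick_pair /w /mirror_prob eqxx i10.
rewrite mulfK // (_ : c / (t * c) = t^-1); last by field; rewrite t0.
(* The Petz symmetry makes the weight of the swapped pair equal to the other one. *)
rewrite (_ : t * c * g t^-1 = c * g t); last by rewrite (petz_sym hg t_gt0); ring.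
rewrite !div1r invfM.
(* With the inverse abstracted, [field] asks only for [c != 0], so the formula needs no positivity
   of [g t]. *)
by move: (g t)^-1 => G; field; rewrite c0.
Qed.
End Mirror.

Theorem theorem5 (R : realType) (N n : nat) (hN : (1 < N)%N) (hn : (0 < n)%N)
    (f ft : R -> R) (hf : petz_function f) (hft : petz_function ft)
    (f_gt0 : forall t : R, 0 < t -> 0 < f t)
    (ft_gt0 : forall t : R, 0 < t -> 0 < ft t) :
  petz_le f ft <->
  (forall (S : density_family R N n) (theta : 'rV[R]_n),
     metric_ge (diag_fisher f S theta) (diag_fisher ft S theta)).
Proof.
split=> [le_f S theta X | le_g].
  rewrite /diag_fisher !diag_approxE; apply: ler_sum => k _.
  apply: ler_wpM2l; first by rewrite -(rmorph0 (real_complex R)) lecR sqr_ge0.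
  by apply: le_fisher => // t t_gt0; apply/le_f/ltW.
apply: petz_le_of_gt0 => // t t_gt0.
have [->|t_neq1] := eqVneq t 1; first by rewrite (petz1 hf) (petz1 hft).
pose i0 : 'I_N := Ordinal (ltnW hN); pose i1 : 'I_N := Ordinal hN.
have i01 : i0 != i1 by [].
pose k0 : 'I_n := Ordinal hn.
(* On a coordinate vector the diagonal approximation agrees with the full metric, which is explicit
   at parameter 0. *)
have := le_g (mirror_family _ _ _ _ _ i01 _ t_gt0 k0) 0 (coord_vec k0).
rewrite /diag_fisher !diag_approx_coord !mirror_fisher // lecR.
rewrite ler_pM2l ?lef_pV2 ?posrE ?f_gt0 ?ft_gt0 //.
have c_gt0 := mirror_weight_gt0 R N i0 t t_gt0.
apply: mulr_gt0; first exact: mulr_gt0.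
by rewrite exprn_even_gt0 //= subr_eq0.
Qed.
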